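(* Let $p$ be a prime number, let $m\geq 1$ be an integer, and let $d=p^m$. Let $\alpha_1,\alpha_2,\dots,\alpha_d$ be the roots of an irreducible polynomial $f(t)\in\mathbb{Q}[t]$ of degree $d$. Suppose that there are integers $a_j\in\mathbb{Z}$, $1\leq j\leq d$, such that $\sum_{j=1}^d a_j\alpha_j=0$. Then $p$ divides $\sum_{j=1}^d a_j$.
   Context: Roots are taken in $\mathbb{C}$ (equivalently, in an algebraic closure of $\mathbb{Q}$); $\alpha_1,\dots,\alpha_d$ lists all $d$ distinct roots of $f$, each exactly once. *)

(* Defs.v *)
From mathcomp Require Export all_boot all_order all_algebra all_field.

(* Main.v *)
Require Import Defs.
From mathcomp Require Import all_boot all_order all_algebra all_field.
From HB Require Import structures.
From mathcomp Require Import all_fingroup all_solvable.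
Import Order.TTheory GRing.Theory Num.Theory.
Local Open Scope ring_scope.

(** Let [P] be a Sylow [p]-subgroup of the Galois group; since the number of
    roots is a power of [p], [P] is transitive on them. The vectors [v] over
    [F_p] with [\sum_j a_(s j) v_j = 0] for all [s] in [P] form a [P]-stable
    space. If it is nonzero, it contains a nonzero [P]-fixed vector, which is
    constant by transitivity, so [p] divides [\sum_j a_j]. If it is zero, the
    integer matrix [(a_(s j))] has a maximal minor that is nonzero mod [p],
    hence nonzero; as the Galois conjugates of the given relation say that this
    matrix kills [alpha], all the roots vanish, which is absurd. *)

(** Orbit-stabilizer: the order of [P], which is the [p]-part of that of [G], equals [p ^ m] times
    the [p]-part of the order of the [G]-stabilizer of [x]. The [P]-stabilizer is a [p]-group inside
    the latter, so its order is at most that [p]-part, and the [P]-orbit has at least [p ^ m]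
    points. *)
Lemma Sylow_atrans (aT : finGroupType) (rT : finType)
    (to : {action aT &-> rT}) (G P : {group aT}) (S : {set rT}) (p m : nat) :
    prime p -> [transitive G, on S | to] -> #|S| = (p ^ m)%N -> (p.-Sylow(G) P)%g ->
  [transitive P, on S | to].
Proof.
move=> p_pr trG cardS sylP; have /andP[sPG _] := sylP.
have [x Sx orbG] := imsetP trG.
suff orbP : orbit to P x = S by apply/imsetP; exists x.
apply/eqP; rewrite eqEcard orbG imsetS //= -orbG cardS.
have cardG := card_orbit_stab to G x.
have cardP := card_orbit_stab to P x.
have stab_le : (#|'C_P[x | to]%g| <= #|'C_G[x | to]%g|`_p)%N.
  apply: dvdn_leq (part_gt0 _ _) _.
  have pP : p.-nat #|'C_P[x | to]%g|.
    by apply: pgroupS (pHall_pgroup sylP); apply: subsetIl.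
  by rewrite -(part_pnat_id pP) partn_dvd // cardSg // setSI.
rewrite -(leq_pmul2r (part_gt0 p #|'C_G[x | to]%g|)).
rewrite -{1}(@part_pnat_id p (p ^ m)) ?pnatX ?pnat_id //.
rewrite -partnM ?expn_gt0 ?cardG_gt0 ?(prime_gt0 p_pr) //.
rewrite -cardS orbG cardG -(card_Hall sylP) -cardP.
rewrite leq_pmul2l //; apply/card_gt0P; exists x; apply: orbit_refl.
Qed.

(** The inverse makes this a right action: the entry at [j] moves to [s j]. *)
Definition rV_perm (R : finType) (n : nat) (v : 'rV[R]_n) (s : 'S_n) :=
  col_perm s^-1%g v.

Lemma rV_perm_is_action (R : finType) (n : nat) :
  is_action [set: 'S_n] (@rV_perm R n).
Proof.
split=> [s u v /rowP eq_uv | u s t _ _]; apply/rowP=> j.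
  by have := eq_uv (s j); rewrite !mxE permK.
by rewrite !mxE invMg permM.
Qed.

Canonical rV_perm_action (R : finType) (n : nat) :=
  Action (@rV_perm_is_action R n).

(** The number of fixed points is congruent to [#|N|] mod [p], and [p] divides [#|N|] since [N] is a
    nontrivial [p]-group. As 0 is fixed, there is another fixed point. *)
Lemma pgroup_fix_rV (p n : nat) (P : {group 'S_n}) (N : {set 'rV['F_p]_n}) v :
    prime p -> (p.-group P)%g -> group_set N ->
    [acts P, on N | rV_perm_action 'F_p n] -> v \in N -> v != 0 ->
  exists2 u, u \in N & u != 0 /\ {in P, forall s, col_perm s u = u}.
Proof.
move=> p_pr pP gN actP Nv v0; have pN := pgroup_fix_mod pP actP.
have p_dvd : (p %| #|N|)%N.
  have : p.-nat #|Group gN|.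
    apply: pnat_dvd (cardSg (subsetT _)) _.
    by rewrite cardsT card_mx card_Fp // pnatX pnat_id.
  case/p_natP=> [[|k] eN]; last by rewrite [#|N|]eN expnS dvdn_mulr.
  have tN : N = 1%g := @card1_trivg _ (Group gN) eN.
  by case/negP: v0; move: Nv; rewrite tN => /set1P ->.
move: p_dvd; rewrite /dvdn pN.
set F := 'Fix_(_ | _)(_)%g => /eqP/eqP; rewrite -/(dvdn p #|F|) => p_dvd.
have F0 : 0 \in F.
  rewrite inE (group1 (Group gN)); apply/afixP=> s _.
  by apply/rowP=> j; rewrite !mxE.
have F_gt1 : (1 < #|F|)%N.
  apply: leq_trans (prime_gt1 p_pr) (dvdn_leq _ p_dvd).
  by apply/card_gt0P; exists 0.
move: F_gt1; rewrite (cardsD1 0) F0 ltnS => /card_gt0P[u].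
rewrite in_setD1 => /andP[u0 /setIP[Nu /afixP fixu]]; exists u => //; split=> // s Ps.
have := fixu s^-1%g; rewrite groupV => /(_ Ps).
by rewrite /= /rV_perm invgK.
Qed.

Lemma pgroup_permuted_relations (F : numFieldType) (p n : nat)
    (P : {group 'S_n}) (a : 'I_n -> int) (x : 'I_n -> F) :
    prime p -> (p.-group P)%g -> [transitive P, on [set: 'I_n] | 'P] ->
    ~~ (p%:Z %| \sum_j a j)%Z ->
    {in P, forall s : 'S_n, exists nu : {rmorphism F -> F},
       forall j, nu (x j) = x (s j)} ->
    \sum_j (a j)%:~R * x j = 0 ->
  forall j, x j = 0.
Proof.
move=> p_pr pP trP p_a autP rel_a.
have rel s : s \in P -> \sum_j (a j)%:~R * x (s j) = 0.
  case/autP=> nu nuE; rewrite -[RHS](rmorph0 nu) -[in RHS]rel_a rmorph_sum.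
  by apply: eq_bigr => j _; rewrite rmorphM rmorph_int nuE.
pose A := \matrix_(k < #|P|, j < n) a ((enum_val k : 'S_n) j).
pose Ap : 'M['F_p]_(_, _) := map_mx intr A.
pose N := [set v : 'rV['F_p]_n | v *m Ap^T == 0].
have NP v s : v \in N -> s \in P -> \sum_j v 0 j * (a (s j))%:~R = 0.
  rewrite inE => /eqP /rowP vA Ps.
  have := vA (enum_rank_in (group1 P) s); rewrite !mxE => {2}<-.
  by apply: eq_bigr => j _; rewrite !mxE enum_rankK_in.
have PN (v : 'rV_n) :
    {in P, forall s : 'S_n, \sum_j v 0 j * (a (s j))%:~R = 0} -> v \in N.
  move=> vP; rewrite inE; apply/eqP/rowP=> k; rewrite !mxE -[RHS](vP _ (enum_valP k)).
  by apply: eq_bigr => j _; rewrite !mxE.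
have gN : group_set N.
  apply/group_setP; split=> [|u v]; first by rewrite inE mul0mx.
  by rewrite !inE => /eqP Nu /eqP Nv; rewrite mulmxDl Nu Nv addr0.
have actP : [acts P, on N | rV_perm_action 'F_p n].
  apply/subsetP=> s Ps; rewrite inE in_setT inE; apply/subsetP=> u Nu; rewrite inE /=.
  (* Pairing the permuted vector with row [t] is pairing [u] with row [s * t]. *)
  apply: PN => t Pt; rewrite -[RHS](NP u (s * t)%g Nu (groupM Ps Pt)).
  rewrite (reindex_inj (@perm_inj _ s)) /=.
  by apply: eq_bigr => j _; rewrite !mxE permK permM.
have fullAp : row_full Ap.
  rewrite /row_full -mxrank_tr; apply: inj_row_free => v /eqP vA.
  apply: contraNeq p_a => v0.
  have Nv : v \in N by rewrite inE.
  have [u Nu [u0 fixu]] := pgroup_fix_rV _ _ _ _ _ p_pr pP gN actP Nv v0.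
  have [j0 uj0] := rV0Pn _ u0.
  have u_const j : u 0 j = u 0 j0.
    have := in_setT j; rewrite -(atransP trP j0 (in_setT j0)).
    by case/orbitP=> s Ps <-; rewrite -{2}(fixu s Ps) mxE.
  rewrite (dvdz_pcharf (pchar_Fp p_pr)) rmorph_sum /=.
  (* For constant [u], the equation at the identity is the sum of the [a j] times the nonzero scalar
     [u 0 j0]. *)
  rewrite -(mulrI_eq0 _ (mulfI uj0)) mulr_sumr; apply/eqP.
  rewrite -[RHS](NP u 1%g Nu (group1 P)); apply: eq_bigr => j _.
  by rewrite u_const perm1.
(* Rows independent mod [p] are chosen, but taken from the integer matrix, so that the minor can be
   read both in ['F_p] and in [F]. *)
pose B := rowsub (fullrankfun fullAp) A.
have detB : \det B != 0.
  have := fullrowsub_unit fullAp; rewrite unitmxE unitfE -map_mxsub det_map_mx.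
  by apply: contraNneq => ->; rewrite rmorph0.
have unitB : map_mx intr B \in @unitmx F n.
  by rewrite unitmxE unitfE det_map_mx intr_eq0.
suff /colP x0 : \col_j x j = 0 by move=> j; have := x0 j; rewrite !mxE.
apply: (can_inj (mulKmx unitB)); rewrite mulmx0; apply/colP=> k.
set s : 'S_n := enum_val (fullrankfun fullAp k).
(* Row [k] of [B] has entries [a (s j)], with [s] acting on the coefficients; reindexing by [s]
   identifies its product with [x] with the relation at [s^-1]. *)
have Ps : s^-1%g \in P by rewrite groupV enum_valP.
rewrite !mxE -[RHS](rel _ Ps) [RHS](reindex_inj (@perm_inj _ s)) /=.
by apply: eq_bigr => j _; rewrite !mxE permK.
Qed.

(** This moves the roots into a finite extension of the rationals, where finite Galois theory
    applies. *)
Lemma splitting_num_field (f : {poly rat}) (n : nat) (x : 'I_n -> algC) :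
    f != 0 -> size f = n.+1 -> injective x ->
    (forall i, root (map_poly ratr f) (x i)) ->
  exists (L : splittingFieldType rat) (toC : {rmorphism L -> algC})
    (y : 'I_n -> L),
    (forall i, toC (y i) = x i) /\
    map_poly (in_alg L) f %= \prod_i ('X - (y i)%:P).
Proof.
move=> f0 sz_f x_inj rfx.
have [L [toC [s s_x genL]]] := num_field_exists (codom x).
have sz_s : size s = n by rewrite -(size_map toC) s_x size_codom card_ord.
pose y (i : 'I_n) := s`_i.
have toCy i : toC (y i) = x i.
  rewrite -(nth_map 0 0) ?sz_s // s_x /codom (nth_map i) ?size_enum_ord //.
  by rewrite nth_ord_enum.
have fE : map_poly toC (map_poly (in_alg L) f) = map_poly ratr f.
  rewrite -map_poly_comp; apply: eq_map_poly => a.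
  by rewrite /= -(fmorph_eq_rat (toC \o in_alg L)).
have s_y : s = [seq y i | i <- enum 'I_n].
  apply: (@eq_from_nth _ 0) => [|i lt_i].
    by rewrite size_map size_enum_ord.
  rewrite sz_s in lt_i.
  rewrite (nth_map (Ordinal lt_i)) ?size_enum_ord //.
  by rewrite (nth_ord_enum _ (Ordinal lt_i)).
(* The product over distinct roots divides [f] and has the same degree. *)
have fy : map_poly (in_alg L) f %= \prod_(z <- s) ('X - z%:P).
  rewrite eqp_sym -dvdp_size_eqp.
    by rewrite size_prod_XsubC sz_s size_map_poly sz_f.
  apply: uniq_roots_dvdp.
    apply/allP=> z; rewrite s_y => /mapP[i _ ->].
    by rewrite -(fmorph_root toC) fE toCy.
  rewrite uniq_rootsE -(map_inj_uniq (fmorph_inj toC)) s_x.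
  by rewrite map_inj_uniq ?enum_uniq.
have splitL : splitting_field_axiom L.
  exists (map_poly (in_alg L) f); last by exists s.
  by apply/polyOverP=> i; rewrite coef_map /= rpredZ ?rpred1.
pose M := FieldExt_isSplittingField.Build rat L splitL.
pose Ls : splittingFieldType rat := HB.pack L M.
by exists Ls, toC, y; split=> //; move: fy; rewrite s_y big_map big_enum.
Qed.

Lemma minPoly_irreducible (K : fieldType) (L : fieldExtType K) (f : {poly K}) (x : L) :
    irreducible_poly f -> root (map_poly (in_alg L) f) x ->
  minPoly 1%VS x %= map_poly (in_alg L) f.
Proof.
move=> [_ irr_f] fx; have /polyOver1P[q Dq] := minPolyOver 1%AS x.
rewrite Dq eqp_map; apply: irr_f; last first.
  rewrite -(dvdp_map (in_alg L)) -Dq minPoly_dvdp //.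
  by apply/polyOver1P; exists f.
by rewrite -(size_map_poly (in_alg L)) -Dq size_minPoly.
Qed.

(** The group is the Galois group of the splitting field, seen on root indices. It is transitive
    because all roots share one minimal polynomial, and its elements extend to automorphisms of
    [algC]. *)
Lemma Galois_perm_group (f : {poly rat}) (n : nat) (x : 'I_n -> algC) :
    (0 < n)%N -> irreducible_poly f -> size f = n.+1 -> injective x ->
    (forall i, root (map_poly ratr f) (x i)) ->
  exists G : {group 'S_n}, [transitive G, on [set: 'I_n] | 'P] /\
    {in G, forall s : 'S_n, exists nu : {rmorphism algC -> algC},
       forall i, nu (x i) = x (s i)}.
Proof.
move=> n_gt0 irr_f sz_f x_inj rfx.
have f0 : f != 0 by rewrite -size_poly_eq0 sz_f.
have [L [toC [y [toCy fy]]]] := splitting_num_field f n x f0 sz_f x_inj rfx.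
have y_inj : injective y by move=> i j e; apply: x_inj; rewrite -!toCy e.
have root_fy z : root (map_poly (in_alg L) f) z = (z \in codom y).
  rewrite (eqp_root fy) -(big_map y xpredT (fun z => 'X - z%:P)) root_prod_XsubC.
  apply/mapP/codomP=> [[i _ ->] | [i ->]]; first by exists i.
  by exists i; rewrite // mem_index_enum.
have root_y i z : root (minPoly 1%VS (y i)) z = (z \in codom y).
  by rewrite (eqp_root (minPoly_irreducible _ _ _ _ irr_f _)) root_fy ?codom_f.
pose E := {:L}%AS.
pose moves (g : gal_of E) (s : 'S_n) := [forall i, g (y i) == y (s i)].
pose G := [set s : 'S_n | [exists g in 'Gal(E / 1)%g, moves g s]].
have perm_of g : g \in 'Gal(E / 1)%g -> {s : 'S_n | moves g s}.
  move=> Gg; have gy i : {j | g (y i) = y j}.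
    apply: sig_eqW; apply/codomP.
    rewrite -(root_y i); apply: root_minPoly_gal Gg _; rewrite ?sub1v ?memvf //.
  pose h i := sval (gy i).
  have hE i : g (y i) = y (h i) by apply: svalP (gy i).
  have h_inj : injective h.
    by move=> i j e; have := hE i; rewrite e -hE => /fmorph_inj/y_inj.
  by exists (perm h_inj); apply/forallP=> i; rewrite permE hE.
have gG : group_set G.
  apply/group_setP; split=> [|s t].
    rewrite inE; apply/existsP; exists 1%g; rewrite group1 /=.
    by apply/forallP=> i; rewrite gal_id perm1.
  rewrite !inE => /existsP[g /andP[Gg /forallP gs]] /existsP[h /andP[Gh /forallP ht]].
  (* Both products apply their left factor first, so the orders agree. *)
  apply/existsP; exists (g * h)%g; rewrite groupM //=; apply/forallP=> i.
  by rewrite galM ?memvf // (eqP (gs i)) (eqP (ht _)) permM.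
exists (Group gG); split=> [|s].
  apply/imsetP; exists (Ordinal n_gt0); rewrite ?inE //.
  apply/esym/setP=> j; rewrite inE; apply/orbitP.
  have [|g Gg gy] := @normalField_root_minPoly _ _ 1%AS E (y (Ordinal n_gt0)) (y j)
    (sub1v _) (normalFieldf _) (memvf _).
    by rewrite root_y codom_f.
  have [s gs] := perm_of g Gg; exists s; last first.
    by apply: y_inj; rewrite -gy /= (eqP (forallP gs _)).
  by rewrite inE; apply/existsP; exists g; rewrite Gg.
rewrite inE => /existsP[g /andP[_ /forallP gs]].
have [nu nuE] := extend_algC_subfield_aut toC g.
by exists nu => i; rewrite -!toCy -(eqP (gs i)); apply/esym/nuE.
Qed.

Theorem theorem3 (p m d : nat) (p_prime : prime p) (m_ge1 : (1 <= m)%N)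
    (d_def : d = (p ^ m)%N)
    (f : {poly rat}) (f_irr : irreducible_poly f) (f_deg : size f = d.+1)
    (alpha : 'I_d -> algC) (alpha_inj : injective alpha)
    (alpha_roots : forall x : algC,
       root (map_poly ratr f) x <-> exists j : 'I_d, x = alpha j)
    (a : 'I_d -> int) (rel_a : \sum_(j < d) (a j)%:~R * alpha j = 0) :
  (p%:Z %| \sum_(j < d) a j)%Z.
Proof.
(* Two indices are needed for the final contradiction: distinct roots cannot all vanish. This is
   where [m_ge1] enters. *)
have d_gt1 : (1 < d)%N.
  rewrite d_def (leq_trans (prime_gt1 p_prime)) // -{1}(expn1 p).
  by rewrite leq_exp2l ?prime_gt1.
have d_gt0 := ltnW d_gt1.
have rf j : root (map_poly ratr f) (alpha j) by apply/alpha_roots; exists j.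
have [G [trG autG]] := Galois_perm_group f d alpha d_gt0 f_irr f_deg alpha_inj rf.
have [P sylP] := Sylow_exists p G.
have trP : [transitive P, on [set: 'I_d] | 'P].
  by apply: (Sylow_atrans _ _ _ G P _ p m p_prime trG _ sylP); rewrite cardsT card_ord.
apply/negPn/negP => p_a.
have alpha0 : forall j, alpha j = 0.
  apply: pgroup_permuted_relations p_prime (pHall_pgroup sylP) trP p_a _ rel_a.
  by move=> s /(subsetP (pHall_sub sylP)); apply: autG.
have /alpha_inj/(congr1 val) //: alpha (Ordinal d_gt0) = alpha (Ordinal d_gt1).
by rewrite !alpha0.
Qed.
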